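(* Let $X$ be a countable regular $T_1$ space without isolated points. (i) If every point of $X$ is $\mathbf{p}^-$, then $X$ is selectively separable (SS). (ii) If every point of $X$ is weakly selective ($\mathbf{ws}$), then $X$ is $R$-separable (RS).
   Context: For $x\in X$ (non-isolated), $\mathcal I_x=\{A\subseteq X: x\notin\overline{A\setminus\{x\}}\}$, an ideal on $X$; $\mathcal I_x^+$ is the family of subsets of $X$ not in $\mathcal I_x$. The point $x$ is $\mathbf{p}^-$ if for every decreasing sequence $(A_n)_n$ of sets in $\mathcal I_x^+$ with $A_n\setminus A_{n+1}\in\mathcal I_x$ for all $n$, there is $B\in\mathcal I_x^+$ such that $B\setminus A_n$ is finite for all $n$. The point $x$ is weakly selective ($\mathbf{ws}$) if for every $A\in\mathcal I_x^+$ and every partition $(F_n)_n$ of $A$ with each $F_n\in\mathcal I_x$, there is $S\subseteq A$ with $S\in\mathcal I_x^+$ such that $S\cap F_n$ has at most one element for each $n$. $X$ is selectively separable (SS) if for any sequence $(D_n)_n$ of dense subsets of $X$ there are finite sets $a_n\subseteq D_n$ such that $\bigcup_n a_n$ is dense in $X$. $X$ is $R$-separable (RS) if for any sequence $(D_n)_n$ of dense subsets of $X$ there are points $x_n\in D_n$ such that $\{x_n:n\in\mathbb N\}$ is dense in $X$. *)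

(* Defs.v *)
From mathcomp Require Import all_boot all_order.
From mathcomp Require Import all_classical topology sequences.

Set Implicit Arguments.
Unset Strict Implicit.
Unset Printing Implicit Defensive.

Local Open Scope classical_set_scope.

(* $\mathcal I_x$, as a family of subsets of X. *)
Definition point_ideal (X : topologicalType) (x : X) : set (set X) :=
  [set A | ~ closure (A `\ x) x].

(* $\mathcal I_x^+$ *)
Definition point_positive (X : topologicalType) (x : X) : set (set X) :=
  ~` point_ideal x.

(* [nonincreasing_seq] refers here to the inclusion order on [set X]. *)
Definition p_minus (X : topologicalType) (x : X) : Prop :=
  forall A : nat -> set X,
    nonincreasing_seq A ->
    (forall n, point_positive x (A n)) ->
    (forall n, point_ideal x (A n `\` A n.+1)) ->
    exists2 B : set X, point_positive x B & forall n, finite_set (B `\` A n).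

(* The library's [partition] requires nonempty pieces. Allowing empty ones (or
   finite partitions) gives an equivalent notion: a positive set is not a finite
   union of members of the ideal, so infinitely many pieces are nonempty and
   they can be reindexed by nat. *)
Definition weakly_selective (X : topologicalType) (x : X) : Prop :=
  forall (A : set X) (F : nat -> set X),
    point_positive x A ->
    partition [set: nat] F A ->
    (forall n, point_ideal x (F n)) ->
    exists S : set X, [/\ S `<=` A, point_positive x S &
      forall n, is_subset1 (S `&` F n)].

Definition selectively_separable (X : topologicalType) : Prop :=
  forall D : nat -> set X, (forall n, dense (D n)) ->
    exists a : nat -> set X,
      [/\ forall n, finite_set (a n), forall n, a n `<=` D n
        & dense (\bigcup_n a n)].

Definition R_separable (X : topologicalType) : Prop :=
  forall D : nat -> set X, (forall n, dense (D n)) ->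
    exists2 x : nat -> X, forall n, D n (x n) & dense (range x).

(* Main.v *)
(** Fix a point x and dense sets D_n. By separation every y <> x has a
    neighborhood O_y with x outside its closure. Cutting D_n down to O_y, with
    every y <> x served by infinitely many indices n, gives sets E_n in the ideal
    of x all of whose tail unions accumulate at x, since every neighborhood of x
    meets some O_y. Then p^- applied to the tails of (E_n), respectively weak
    selectivity applied to the disjointed E_n, gives small selections from the
    D_n accumulating at x. Countably many points are handled simultaneously by
    splitting the sequence (D_n) into infinitely many subsequences. *)
Require Import Defs.
From mathcomp Require Import all_boot all_order.
From mathcomp Require Import all_classical topology sequences.
Local Open Scope classical_set_scope.

Set Implicit Arguments.
Unset Strict Implicit.

Lemma point_positiveP (X : topologicalType) (x : X) (A : set X) :
  point_positive x A <-> limit_point A x.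
Proof.
split=> [/contrapT Ax U /Ax[y [[Ay /eqP yx] Uy]]|Ax]; first by exists y.
by apply => U /Ax[y [/eqP yx Ay Uy]]; exists y.
Qed.

Lemma point_idealS (X : topologicalType) (x : X) (A B : set X) :
  A `<=` B -> point_ideal x B -> point_ideal x A.
Proof. by move=> AB xB xA; apply: xB; exact: (closureS (setSD AB) xA). Qed.

Lemma point_positiveS (X : topologicalType) (x : X) (A B : set X) :
  A `<=` B -> point_positive x A -> point_positive x B.
Proof. by move=> AB xA xB; apply: xA; exact: point_idealS xB. Qed.

Lemma point_ideal_bigcup (X : topologicalType) (x : X) (I : choiceType)
    (D : set I) (F : I -> set X) :
  finite_set D -> (forall i, point_ideal x (F i)) ->
  point_ideal x (\bigcup_(i in D) F i).
Proof.
move=> Dfin xF.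
have clF : closed (\bigcup_(i in D) closure (F i `\ x)).
  by apply: closed_bigcup => // i _; exact: closed_closure.
move=> xU; suff [i _] : (\bigcup_(i in D) closure (F i `\ x)) x by exact: xF.
rewrite (iffLR (closure_id _) clF); apply: closureS xU => y [[i Di Fiy] yx].
by exists i => //; apply: subset_closure.
Qed.

Lemma point_ideal_finite (X : topologicalType) (x : X) (A : set X) :
  accessible_space X -> finite_set A -> point_ideal x A.
Proof.
move=> T1 Afin; have /(iffLR accessible_finite_set_closed) := T1.
move=> /(_ _ (finite_setD [set x] Afin))/closure_id Acl.
by rewrite /point_ideal /= -Acl => -[_]; apply.
Qed.

Lemma point_positiveU (X : topologicalType) (x : X) (A B : set X) :
  point_positive x (A `|` B) -> point_ideal x A -> point_positive x B.
Proof.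
by move=> + xA xB; apply; rewrite /point_ideal /= setDUl closureU => -[].
Qed.

Lemma separating_nbhs (X : topologicalType) (x y : X) :
  regular_space X -> accessible_space X -> y <> x ->
  exists2 O : set X, nbhs y O & ~ closure O x.
Proof.
move=> regX T1 /eqP /T1[A [Aop /set_mem yA /set_mem xA]].
have [O yO OA] := regX y A (open_nbhs_nbhs (conj Aop yA)).
by exists O => // /OA.
Qed.

(** The images of the maps [q x] are pairwise disjoint infinite sets of indices: they serve both to
    repeat each point infinitely often and to allot a subsequence to each point. *)
Lemma countable_split (T : Type) : countable [set: T] ->
  exists q : T -> nat -> nat, forall x y i j, q x i = q y j -> x = y /\ i = j.
Proof.
move=> /countable_injP[f f_inj]; exists (fun x j => choice.pickle (f x, j)).
move=> x y i j /(pcan_inj choice.pickleK)[fxy ->]; split=> //.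
by apply: f_inj fxy; rewrite in_setT.
Qed.

Lemma dense_in_ideal (X : topologicalType) (x : X) (D : nat -> set X) :
  countable [set: X] -> regular_space X -> accessible_space X ->
  ~ isolated [set: X] x -> (forall n, dense (D n)) ->
  exists E : nat -> set X, [/\ forall n, E n `<=` D n,
    forall n, point_ideal x (E n) &
    forall n, point_positive x (\bigcup_(m in [set m | (n <= m)%N]) E m)].
Proof.
move=> cX regX T1 nisox dD.
have [q q_inj] := countable_split cX.
have /choice[O OP] y : exists O : set X, y <> x -> nbhs y O /\ ~ closure O x.
  have [yx|yx] := pselect (y = x); first by exists set0.
  by have [O] := separating_nbhs regX T1 yx; exists O.
(* Since [q] is injective, [n] determines [y]: [E n] is [D n] cut down to a single [O y], or is
   empty when [n] codes no [y <> x]. *)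
pose E n := D n `&` [set z | exists y j, [/\ y <> x, n = q y j & O y z]].
exists E; split=> [n z []//|n|n].
  have [[y [j [yx nE]]]|noy] := pselect (exists y j, y <> x /\ n = q y j).
    apply: (@point_idealS _ _ _ (O y)).
      by move=> z [_ [y' [j' [_]]]]; rewrite nE => /q_inj[->].
    by move=> xO; apply: (OP y yx).2; apply: closureS xO; exact: subDsetl.
  apply: (@point_idealS _ _ _ set0); last by rewrite /point_ideal /= set0D closure0.
  by move=> z [_ [y [j [yx nE _]]]]; apply: noy; exists y, j.
apply/point_positiveP => U; rewrite nbhsE => -[V [Vop Vx] VU].
have [y [Vy yx]] : exists y, V y /\ y <> x.
  apply: contrapT => nV; apply: nisox; split; first by rewrite in_setT.
  exists V; first exact: open_nbhs_nbhs.
  rewrite setIT; apply/seteqP; split=> [z Vz|_ ->//].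
  by apply: contrapT => zx; apply: nV; exists z.
(* [y] owns infinitely many indices, so one of them lies in the tail beyond [n]; density of that [D]
   is then tested on an open set containing [y]. *)
have [j nj] : exists j, (n < q y j)%N by apply: injective_gtn => i j /q_inj[].
have [Oy xO] := OP y yx.
have [||z [[Oz Vz] Dz]] := dD (q y j) ((O y)° `&` V).
- by exists y.
- by apply: openI => //; exact: open_interior.
have Oyz := interior_subset Oz.
exists z; split; last exact: VU.
- by apply/eqP => zx; apply: xO; rewrite -zx; exact: subset_closure.
- by exists (q y j); [exact: ltnW|split => //; exists y, j].
Qed.

Lemma p_minus_selection (X : topologicalType) (x : X) (D : nat -> set X) :
  countable [set: X] -> regular_space X -> accessible_space X ->
  ~ isolated [set: X] x -> p_minus x -> (forall n, dense (D n)) ->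
  exists a : nat -> set X, (forall n, finite_set (a n) /\ a n `<=` D n) /\
    closure (\bigcup_n a n) x.
Proof.
move=> cX regX T1 nisox px dD.
have [E [ED xE xA]] := dense_in_ideal cX regX T1 nisox dD.
have /countable_injP[c c_inj] := cX.
pose A n := \bigcup_(m in [set m | (n <= m)%N]) E m.
have AS n : A n.+1 `<=` A n by move=> z [m /= nm Em]; exists m => //=; exact: ltnW.
have AD n : A n `\` A n.+1 `<=` E n.
  move=> z [[m /= nm Emz] nA]; move: nm; rewrite leq_eqVlt => /predU1P[->//|nm].
  by exfalso; apply: nA; exists m.
have [||B xB BA] := px A _ xA.
- by apply/nonincreasing_seqP => n; apply/subsetPset; exact: AS.
- by move=> n; apply: point_idealS (xE n); exact: AD.
(* A point of B in every [A n] lies in infinitely many [E n]; it may be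
   selected at any of them whose index exceeds its code. *)
pose a n := (B `&` E n) `&` (~` A n.+1 `|` [set z | (c z <= n)%N]).
exists a; split=> [n|].
  split; last by move=> z [[_ /ED]].
  (* The first half lies in [B] minus [A n.+1]; the second has codes at most [n], and [c] is
     injective. *)
  rewrite /a setIUr finite_setU; split.
    by apply: sub_finite_set (BA n.+1) => z [[Bz _] nA].
  apply: (@sub_finite_set _ _ (c @^-1` `I_n.+1)); first by move=> z [].
  apply: finite_preimage => //; by move=> y z _ _; apply: c_inj; rewrite in_setT.
(* Points of [B] outside [A 0] may never be selected, but they are finitely many, so by T1 removing
   them keeps [B] positive. *)
suff BaA : B `&` A 0 `<=` \bigcup_n a n.
  have xBA : point_positive x (B `&` A 0).
    apply: (@point_positiveU _ _ (B `\` A 0)); first by rewrite setUC setUIDK.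
    exact: point_ideal_finite.
  have /contrapT := point_positiveS BaA xBA.
  by apply: closureS; exact: subDsetl.
move=> z [Bz A0z].
have [zA|/existsNP nzA] := pselect (forall n, A n z).
  by have [n /= cn En] := zA (c z); exists n => //; split=> //; right.
(* The least index whose tail misses [z] is a successor [n.+1], because [z] is in [A 0]; hence [z]
   lies in [A n] minus [A n.+1], a part of [E n]. *)
case: (ex_minnP (P := fun n => `[< ~ A n z >])).
  by have [n nA] := nzA; exists n; exact/asboolP.
move=> [|n] /asboolP nA nmin; first by [].
have Anz : A n z.
  apply: contrapT => nAn; have /nmin : `[< ~ A n z >] by exact/asboolP.
  by rewrite ltnn.
by exists n => //; split; [split=> //; exact: AD|left].
Qed.

Lemma weakly_selective_selection (X : topologicalType) (x : X)
    (D : nat -> set X) :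
  countable [set: X] -> regular_space X -> accessible_space X ->
  ~ isolated [set: X] x -> weakly_selective x -> (forall n, dense (D n)) ->
  exists y : nat -> X, (forall n, D n (y n)) /\ closure (range y) x.
Proof.
move=> cX regX T1 nisox wsx dD.
have [E [ED xE xA]] := dense_in_ideal cX regX T1 nisox dD.
pose F := seqDU E.
have xF n : point_ideal x (F n) by apply: point_idealS (xE n); exact: subset_seqDU.
pose I := [set n | F n !=set0].
have AE : \bigcup_n F n = \bigcup_(n in I) F n.
  by apply/seteqP; split=> z [n Hn Fz]; exists n => //; exists z.
have {}xA : point_positive x (\bigcup_n F n).
  rewrite -seqDU_bigcup_eq; apply: point_positiveS (xA 0) => z [n _ Ez].
  by exists n.
(* Disjointing may create empty pieces, which [partition] forbids. Finitely many pieces would have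
   their union in the ideal, so the nonempty ones can be enumerated by [g]. *)
have Iinf : infinite_set I.
  by move=> Ifin; apply: xA; rewrite AE; exact: point_ideal_bigcup.
have /card_esym/card_set_bijP[g [gI g_inj g_surj]] :
  (I #= [set: nat])%card by apply: eq_card_nat.
have [|n|S [SA xS SF]] := wsx (\bigcup_n F n) (F \o g) xA; last 2 first.
- exact: xF.
- have /choice[y Hy] n : exists y, D n y /\ S `&` F n `<=` [set y].
    (* Where [S] misses [F n], any point of [D n] will do: extra points only enlarge the closure. *)
    have [[y [Sy Fy]]|SF0] := pselect (S `&` F n !=set0); last first.
      have [||y [_ Dy]] := dD n setT; [by exists x|exact: openT|].
      by exists y; split=> // z SFz; exfalso; apply: SF0; exists z.
    exists y; split; first by apply: ED; exact: subset_seqDU Fy.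
    have [|k _ gk] := g_surj n; first by exists y.
    by move=> z SFz; apply: (SF k) => //=; rewrite gk.
  exists y; split=> [n|]; first by case: (Hy n).
  have /contrapT := xS; apply: closureS => z [Sz _].
  by have [n _ Fz] := SA z Sz; exists n => //; apply/esym/(Hy n).2.
- split=> [|i j _ _ Fij|i _]; last exact: gI.
    rewrite AE; apply/seteqP; split=> z [n nI Fz].
      by exists (g n); first exact: (gI n).
    by have [k _ gk] := g_surj n nI; exists k => //=; rewrite gk.
  by apply: g_inj; rewrite ?in_setT //; exact: (trivIset_seqDU E).
Qed.

(** [Q] stands for the admissible selections, finite subsets or singletons. Each point [x] uses only
    the sets indexed by [q x], so the choices never conflict, and their union has every point in its
    closure. *)
Lemma simultaneous_selection (X : topologicalType)
    (Q : set X -> set X -> Prop) :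
  [set: X] !=set0 -> countable [set: X] ->
  (forall (x : X) (D : nat -> set X), (forall n, dense (D n)) ->
    exists a : nat -> set X, (forall n, Q (D n) (a n)) /\
      closure (\bigcup_n a n) x) ->
  forall D : nat -> set X, (forall n, dense (D n)) ->
    exists a : nat -> set X, (forall n, Q (D n) (a n)) /\
      dense (\bigcup_n a n).
Proof.
move=> [x0 _] cX QX D dD; have [q q_inj] := countable_split cX.
have /choice[b bP] x : exists b : nat -> set X,
    (forall j, Q (D (q x j)) (b j)) /\ closure (\bigcup_j b j) x.
  by apply: (QX x (D \o q x)) => j; exact: dD.
have /choice[a aP] n : exists a : set X,
    Q (D n) a /\ forall x j, n = q x j -> a = b x j.
  have [[x [j ->]]|noq] := pselect (exists x j, n = q x j).
    exists (b x j); split; first exact: (bP x).1.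
    by move=> y k /q_inj[-> ->].
  (* An index allotted to no point still needs an admissible selection; the constant sequence [D n]
     at [x0] supplies one. *)
  have [a [Qa _]] := QX x0 (fun=> D n) (fun=> dD n).
  by exists (a 0); split=> // x j nE; exfalso; apply: noq; exists x, j.
exists a; split=> [n|O [x Ox] Oop]; first exact: (aP n).1.
have [|z [[j _ bz] Oz]] := (bP x).2 O; first exact: open_nbhs_nbhs.
exists z; split=> //; exists (q x j) => //.
by rewrite ((aP (q x j)).2 x j).
Qed.

Unset Implicit Arguments.
Set Strict Implicit.

Theorem theorem3p6 (X : topologicalType)
    (X_nonempty : [set: X] !=set0)
    (X_countable : countable [set: X])
    (X_regular : regular_space X)
    (X_T1 : accessible_space X)
    (X_no_isolated : forall x : X, ~ isolated [set: X] x) :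
  ((forall x : X, p_minus x) -> selectively_separable X) /\
  ((forall x : X, weakly_selective x) -> R_separable X).
Proof.
split=> [pX|wsX] D dD.
  have [|a [aP da]] :=
      @simultaneous_selection X (fun D a => finite_set a /\ a `<=` D)
        X_nonempty X_countable _ D dD.
    by move=> x {}D {}dD; exact: p_minus_selection.
  by exists a; split=> // n; case: (aP n).
have [|a [/choice[y yP] da]] :=
    @simultaneous_selection X (fun D a => exists y, D y /\ a = [set y])
      X_nonempty X_countable _ D dD.
  move=> x {}D {}dD.
  have [y [Dy xy]] := weakly_selective_selection X_countable X_regular X_T1
    (X_no_isolated x) (wsX x) dD.
  exists (fun n => [set y n]); split=> [n|]; first by exists (y n).
  by rewrite bigcup_imset1.
exists y => [n|]; first by case: (yP n).
suff -> : range y = \bigcup_n a n by [].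
by rewrite -bigcup_imset1; apply: eq_bigcupr => n _; case: (yP n).
Qed.
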